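(* Let $G_{1}$ and $G_{2}$ be two simple connected graphs of orders $m$ and $n$, respectively, let $u\in V(G_{1})$ and $v\in V(G_{2})$, and let $G$ be the graph obtained from $G_{1}$ and $G_{2}$ (taken vertex-disjoint) by identifying $u$ with $v$. Let $f_{1}$ be a harmonic eigenfunction associated with $\rho(\mathcal{L}(G_{1}))$. If $f_{1}(u)=0$, then $\rho(\mathcal{L}(G))\geq\rho(\mathcal{L}(G_{1}))$.
   Context: For a simple graph $G$, $A$ is its adjacency matrix, $D$ the diagonal matrix of vertex degrees $d(x)$, $L=D-A$ its Laplacian and $\mathcal{L}(G)=D^{-1/2}LD^{-1/2}$ its normalized Laplacian; $\rho(\mathcal{L}(G))$ is its spectral radius, i.e. its largest eigenvalue. Functions $f:V(G)\to\mathbb{R}$ are viewed as vectors; $e$ is the all-ones vector and $f\perp De$ means $\sum_x d(x)f(x)=0$. With $R(f)=\frac{\sum_{xy\in E(G)}(f(x)-f(y))^2}{\sum_{x}d(x)f(x)^2}$, one has $\rho(\mathcal{L}(G))=\sup_{f\neq0,\,f\perp De}R(f)$; a harmonic eigenfunction associated with $\rho(\mathcal{L}(G))$ is a nonzero $f\perp De$ with $R(f)=\rho(\mathcal{L}(G))$. *)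

(* Defs.v *)
From HB Require Import structures.
From mathcomp Require Import all_boot all_order all_algebra.
From mathcomp Require Import classical_sets reals.

Set Implicit Arguments.
Unset Strict Implicit.
Unset Printing Implicit Defensive.

Import Order.TTheory GRing.Theory Num.Theory.

Local Open Scope ring_scope.

Record sgraph := SGraph {
  vertex :> finType;
  adj : rel vertex;
  adj_sym : symmetric adj;
  adj_irrefl : irreflexive adj
}.

Definition connected_graph (G : sgraph) : Prop :=
  (0 < #|G|)%N /\ forall x y : G, connect (@adj G) x y.

Definition deg (G : sgraph) (x : G) : nat := #|[set y | adj x y]|.

Section Coalescence.
Variables (G1 G2 : sgraph) (u : G1) (v : G2).

(* The vertex [inl u] stands for both u and v. *)
Definition coal_vertex : finType := (G1 + {y : G2 | y != v})%type.

Definition coal_adj : rel coal_vertex := fun a b =>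
  match a, b with
  | inl x, inl y => adj x y
  | inr x, inr y => adj (val x) (val y)
  | inl x, inr y => (x == u) && adj v (val y)
  | inr x, inl y => (y == u) && adj (val x) v
  end.

Lemma coal_adj_sym : symmetric coal_adj.
Proof. by move=> [x|x] [y|y] /=; rewrite adj_sym. Qed.

Lemma coal_adj_irrefl : irreflexive coal_adj.
Proof. by move=> [x|x] /=; rewrite adj_irrefl. Qed.

Definition coalescence : sgraph := SGraph coal_adj_sym coal_adj_irrefl.

End Coalescence.

Section Spectrum.
Variable R : realType.

(* The supremum is a maximum whenever M has a real eigenvalue, in particular
   for every symmetric M of positive size. *)
Definition largest_eigenvalue (n : nat) (M : 'M[R]_n) : R :=
  sup [set a : R | eigenvalue M a]%classic.

Variable G : sgraph.

(* Row and column i correspond to the vertex [enum_val i]. *)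
Definition adjacency_mx : 'M[R]_#|G| :=
  \matrix_(i, j) (adj (enum_val i) (enum_val j))%:R.

Definition degree_mx : 'M[R]_#|G| :=
  diag_mx (\row_i (deg (enum_val i))%:R).

(* An isolated vertex gets the entry 0, since 0^-1 = 0. *)
Definition degree_mx_invsqrt : 'M[R]_#|G| :=
  diag_mx (\row_i (Num.sqrt (deg (enum_val i))%:R)^-1).

Definition laplacian : 'M[R]_#|G| := degree_mx - adjacency_mx.

Definition normalized_laplacian : 'M[R]_#|G| :=
  degree_mx_invsqrt *m laplacian *m degree_mx_invsqrt.

Definition rhoL : R := largest_eigenvalue normalized_laplacian.

(* The double sum runs over ordered pairs, so each edge is counted twice. *)
Definition edge_energy (f : {ffun G -> R}) : R :=
  2^-1 * \sum_(x : G) \sum_(y : G | adj x y) (f x - f y) ^+ 2.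

Definition rayleigh (f : {ffun G -> R}) : R :=
  edge_energy f / \sum_(x : G) (deg x)%:R * f x ^+ 2.

Definition harmonic_eigenfunction (f : {ffun G -> R}) : Prop :=
  [/\ f != 0, \sum_(x : G) (deg x)%:R * f x = 0 & rayleigh f = rhoL].

End Spectrum.

(* Main.v *)
(** Extend f1 by zero to G. As f1(u) = 0, no edge of G2 contributes to the energy
    and the change of degree at u does not affect the weighted norm, so the
    Rayleigh quotient is unchanged; and every Rayleigh quotient on G is at most
    the largest eigenvalue of the normalized Laplacian of G, by the variational
    principle for real symmetric matrices. *)
Require Import Defs.
From HB Require Import structures.
From mathcomp Require Import all_boot all_order all_algebra.
From mathcomp Require Import classical_sets reals.
From mathcomp Require Import ring lra.

Set Implicit Arguments.
Unset Strict Implicit.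
Unset Printing Implicit Defensive.

Import Order.TTheory GRing.Theory Num.Theory.

Local Open Scope ring_scope.

(** * Quadratic forms of real matrices *)

Definition qform (R : pzRingType) (n : nat) (M : 'M[R]_n) (x : 'rV[R]_n) : R :=
  (x *m M *m x^T) 0 0.

Lemma qformE (R : comPzRingType) (n : nat) (M : 'M[R]_n) (x : 'rV[R]_n) :
  qform M x = \sum_i \sum_j x 0 i * M i j * x 0 j.
Proof.
rewrite /qform mxE exchange_big; apply: eq_bigr => j _.
by rewrite !mxE mulr_suml.
Qed.

Lemma qform1E (R : comPzRingType) (n : nat) (x : 'rV[R]_n) :
  qform 1%:M x = \sum_i x 0 i ^+ 2.
Proof.
rewrite /qform mulmx1 mxE; apply: eq_bigr => i _; by rewrite mxE expr2.
Qed.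

Lemma qform_scalarB (R : comPzRingType) (n : nat) (M : 'M[R]_n) (a : R)
    (x : 'rV[R]_n) : qform (a%:M - M) x = a * qform 1%:M x - qform M x.
Proof.
by rewrite /qform mulmxBr mulmxBl mulmx1 mul_mx_scalar -scalemxAl !mxE.
Qed.

Section QuadraticForms.
Variable R : realFieldType.

Lemma qform1_ge0 (n : nat) (x : 'rV[R]_n) : 0 <= qform 1%:M x.
Proof. by rewrite qform1E sumr_ge0 // => i _; rewrite sqr_ge0. Qed.

Lemma qform1_gt0 (n : nat) (x : 'rV[R]_n) : x != 0 -> 0 < qform 1%:M x.
Proof.
move=> x0; rewrite lt_def qform1_ge0 andbT; apply: contra x0.
rewrite qform1E psumr_eq0 => [/allP h|i _]; last exact: sqr_ge0.
apply/eqP/rowP => i; rewrite mxE; apply/eqP.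
by rewrite -sqrf_eq0; apply: (implyP (h i (mem_index_enum i))).
Qed.

Lemma qform_bounded (n : nat) (M : 'M[R]_n) :
  exists2 C, 0 < C & forall x, qform M x <= C * qform 1%:M x.
Proof.
(* Each product [|x 0 i| * |x 0 j|] is at most the squared norm; the added 1 keeps the constant
   positive when [M] is zero. *)
exists (1 + \sum_i \sum_j `|M i j|).
  by rewrite ltr_pwDl // sumr_ge0 // => i _; rewrite sumr_ge0.
move=> x; rewrite mulrDl mul1r; apply: ler_wpDl; first exact: qform1_ge0.
rewrite qformE mulr_suml; apply: ler_sum => i _.
rewrite mulr_suml; apply: ler_sum => j _.
have le_sq k : x 0 k ^+ 2 <= qform 1%:M x.
  by rewrite qform1E (bigD1 k) //= lerDl sumr_ge0 // => l _; rewrite sqr_ge0.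
have le_abs : `|x 0 i| * `|x 0 j| <= qform 1%:M x.
  have := le_sq i; have := le_sq j.
  rewrite -[x 0 i ^+ 2]real_normK ?num_real //.
  rewrite -[x 0 j ^+ 2]real_normK ?num_real //.
  have := sqr_ge0 (`|x 0 i| - `|x 0 j|).
  by move: `|x 0 i| `|x 0 j| (qform _ _) => a b q; nra.
apply: le_trans (ler_norm _) _; rewrite !normrM mulrAC mulrC.
by rewrite ler_wpM2l.
Qed.

(** The quadratic polynomial [t |-> qform A (x + t *: y)] is nonnegative everywhere, which forces
    its discriminant to be nonpositive. *)
Lemma qform_CauchySchwarz (n : nat) (A : 'M[R]_n) :
  A^T = A -> (forall x, 0 <= qform A x) ->
  forall x y : 'rV_n, (x *m A *m y^T) 0 0 ^+ 2 <= qform A x * qform A y.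
Proof.
move=> symA psdA x y; set b := (_ *m _) 0 0.
have yAx : (y *m A *m x^T) 0 0 = b.
  have -> : y *m A *m x^T = (x *m A *m y^T)^T.
    by rewrite !trmx_mul trmxK symA mulmxA.
  by rewrite mxE.
have entryD (P Q : 'M[R]_1) : (P + Q) 0 0 = P 0 0 + Q 0 0 by rewrite mxE.
have entryZ a (P : 'M[R]_1) : (a *: P) 0 0 = a * P 0 0 by rewrite mxE.
have quad t : 0 <= qform A x + 2 * t * b + t ^+ 2 * qform A y.
  have := psdA (x + t *: y); rewrite /qform linearD linearZ /= !mulmxDl !mulmxDr.
  rewrite -!scalemxAr -!scalemxAl !entryD !entryZ yAx.
  by rewrite -/b -/(qform A x) -/(qform A y); congr (_ <= _); ring.
have := psdA x; have := psdA y; move: quad.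
move: (qform A x) (qform A y) b {yAx} => a c b quad c0 a0.
have [c_eq0|c_neq0] := eqVneq c 0.
  have [->|b0] := eqVneq b 0; first by rewrite expr0n mulr_ge0.
  (* With [c = 0] the polynomial is affine in [t]; this [t] gives it the value -1. *)
  have := quad (- (a + 1) / (2 * b)).
  have -> : 2 * (- (a + 1) / (2 * b)) * b = - (a + 1) by field.
  by rewrite c_eq0; lra.
have cgt0 : 0 < c by rewrite lt_def c_neq0.
(* The minimum of the polynomial is attained here. *)
have := quad (- b / c).
have -> : a + 2 * (- b / c) * b + (- b / c) ^+ 2 * c = (a * c - b ^+ 2) / c.
  by field.
by rewrite pmulr_lge0 ?invr_gt0 // subr_ge0.
Qed.

(* An invertible positive semidefinite matrix is bounded below: Cauchy-Schwarz
   for the form of [A] gives [|xA|^4 <= qform A x * qform A (xA)], hence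
   [|xA|^2 <= C * qform A x], while [|x|^2 <= C' |xA|^2] as [A] is invertible. *)
Lemma qform_coercive (n : nat) (A : 'M[R]_n) :
  A^T = A -> (forall x, 0 <= qform A x) -> A \in unitmx ->
  exists2 K, 0 < K & forall x, qform 1%:M x <= K * qform A x.
Proof.
move=> symA psdA unitA.
have [C C0 boundA] := qform_bounded A.
have [C' C'0 boundV] := qform_bounded (invmx A *m (invmx A)^T).
exists (C' * C) => [|x]; first exact: mulr_gt0.
set y := x *m A.
have -> : qform 1%:M x = qform (invmx A *m (invmx A)^T) y.
  have xE : x = y *m invmx A by rewrite /y mulmxK.
  by rewrite xE /qform mulmx1 trmx_mul !mulmxA.
apply: le_trans (boundV y) _; rewrite -mulrA ler_pM2l //.
have := qform_CauchySchwarz symA psdA x y.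
have -> : (x *m A *m y^T) 0 0 = qform 1%:M y by rewrite /qform mulmx1.
move=> CS; have [y0|] := eqVneq y 0.
  by rewrite y0 {1}/qform !mul0mx mxE mulr_ge0 // ltW.
move/qform1_gt0 => y0; rewrite -(ler_pM2r y0) -expr2.
by apply: le_trans CS _; rewrite [C * _]mulrC -mulrA ler_wpM2l.
Qed.

End QuadraticForms.

(** * Variational principle for symmetric matrices *)

Section LargestEigenvalue.
Variable R : realType.
Local Open Scope classical_set_scope.

(* The supremum of the Rayleigh quotient is an eigenvalue without any appeal to
   compactness: if [l%:M - M] were invertible it would be coercive, and the
   quotient would stay away from [l]. *)
Lemma qform_le_largest_eigenvalue (n : nat) (M : 'M[R]_n) (x : 'rV[R]_n) :
  M^T = M -> qform M x <= largest_eigenvalue M * qform 1%:M x.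
Proof.
move=> symM; have [->|x0] := eqVneq x 0.
  by rewrite /qform !mul0mx mxE mulr0.
pose Q := [set a | exists2 y : 'rV[R]_n, y != 0 & a = qform M y / qform 1%:M y].
have [C C0 boundM] := qform_bounded M.
have QC : has_ubound Q.
  by exists C => _ [y /qform1_gt0 y0 ->]; rewrite ler_pdivrMr.
have Q0 : Q !=set0 by exists (qform M x / qform 1%:M x), x.
pose l := sup Q.
have ray_le y : y != 0 -> qform M y / qform 1%:M y <= l.
  by move=> y0; apply: ub_le_sup => //; exists y.
have qform_le y : qform M y <= l * qform 1%:M y.
  have [->|y0] := eqVneq y 0; first by rewrite /qform !mul0mx mxE mulr0.
  by rewrite -ler_pdivrMr ?ray_le // qform1_gt0.
(* An eigenvalue is the Rayleigh quotient of its eigenvector. This bounds the spectrum, so the [sup]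
   in [largest_eigenvalue] is a genuine supremum. *)
have eig_le : ubound [set a | eigenvalue M a] l.
  move=> a /eigenvalueP [y yM y0]; have := qform_le y.
  by rewrite {1}/qform yM -scalemxAl mxE -[y in y *m _]mulmx1 ler_pM2r ?qform1_gt0.
have eig_l : eigenvalue M l.
  apply: contraT; rewrite /eigenvalue /eigenspace negbK kermx_eq0 /row_free.
  rewrite -mxrank_opp opprB -/(row_free _) row_free_unit => unitA.
  have symA : (l%:M - M)^T = l%:M - M by rewrite linearB /= tr_scalar_mx symM.
  have psdA y : 0 <= qform (l%:M - M) y by rewrite qform_scalarB subr_ge0.
  have [K K0 coer] := qform_coercive symA psdA unitA.
  (* Dividing the coercivity bound by [K] and by the squared norm puts every quotient below
     [l - K^-1]. *)
  suff : l <= l - K^-1 by rewrite lerBrDr gerDl leNgt invr_gt0 K0.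
  apply: ge_sup => // _ [y y0 ->]; have y1 := qform1_gt0 y0.
  rewrite ler_pdivrMr // mulrBl lerBrDr -lerBrDl -qform_scalarB.
  by rewrite ler_pdivrMl.
apply: le_trans (qform_le x) _; rewrite ler_wpM2r ?qform1_ge0 //.
by apply: ub_le_sup => //; exists l.
Qed.

End LargestEigenvalue.

(** * Rayleigh quotients of functions on a graph *)

Section RayleighQuotient.
Variables (R : realType) (G : sgraph).

Lemma degE (x : G) : deg x = (\sum_(y : G | adj x y) 1)%N.
Proof. by rewrite /deg -sum1_card; apply: eq_bigl => y; rewrite inE. Qed.

(** Expand the square: by symmetry of [adj], both square terms sum to the degree-weighted norm, and
    the factor 1/2 absorbs the double counting. *)
Lemma edge_energyE (f : {ffun G -> R}) :
  edge_energy f = \sum_x (deg x)%:R * f x ^+ 2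
                  - \sum_x \sum_(y | adj x y) f x * f y.
Proof.
have sumx : \sum_(x : G) \sum_(y : G | adj x y) f x ^+ 2
    = \sum_x (deg x)%:R * f x ^+ 2.
  apply: eq_bigr => x _; rewrite degE natr_sum mulr_suml.
  by under [RHS]eq_bigr do rewrite mul1r.
have sumy : \sum_(x : G) \sum_(y : G | adj x y) f y ^+ 2
    = \sum_x (deg x)%:R * f x ^+ 2.
  rewrite -sumx (exchange_big_dep xpredT) //=; apply: eq_bigr => x _.
  by apply: eq_bigl => y; rewrite adj_sym.
rewrite /edge_energy.
have -> : \sum_(x : G) \sum_(y : G | adj x y) (f x - f y) ^+ 2
  = \sum_(x : G) \sum_(y : G | adj x y) f x ^+ 2
    + \sum_(x : G) \sum_(y : G | adj x y) f y ^+ 2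
    - 2 * \sum_(x : G) \sum_(y : G | adj x y) f x * f y.
  rewrite mulr_sumr -big_split -sumrB; apply: eq_bigr => x _.
  rewrite mulr_sumr -big_split -sumrB; apply: eq_bigr => y _ /=.
  by ring.
by rewrite sumx sumy; field.
Qed.

Lemma edge_energy_ge0 (f : {ffun G -> R}) : 0 <= edge_energy f.
Proof.
rewrite mulr_ge0 ?invr_ge0 ?ler0n // sumr_ge0 // => x _.
by rewrite sumr_ge0 // => y _; rewrite sqr_ge0.
Qed.

Lemma qform_laplacian (z : 'rV[R]_#|G|) :
  qform (laplacian R G) z = edge_energy [ffun x => z 0 (enum_rank x)].
Proof.
rewrite edge_energyE qformE.
have reidx (F : 'I_#|G| -> R) : \sum_i F i = \sum_(x : G) F (enum_rank x).
  by rewrite (reindex _ (onW_bij _ (@enum_rank_bij G))).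
rewrite reidx -sumrB; apply: eq_bigr => x _; rewrite ffunE.
rewrite (eq_bigr (fun j =>
  z 0 (enum_rank x) * degree_mx R G (enum_rank x) j * z 0 j
  - z 0 (enum_rank x) * adjacency_mx R G (enum_rank x) j * z 0 j)); last first.
  move=> j _; rewrite /laplacian.
  by move: (degree_mx R G) (adjacency_mx R G) => D A; rewrite !mxE; ring.
rewrite sumrB; congr (_ - _).
  rewrite (bigD1 (enum_rank x)) //= big1 => [|j jx].
    by rewrite !mxE eqxx mulr1n enum_rankK addr0; ring.
  by rewrite !mxE eq_sym (negbTE jx) mulr0n mulr0 mul0r.
rewrite reidx [RHS]big_mkcond; apply: eq_bigr => y _.
rewrite !mxE !enum_rankK ffunE; case: (adj x y); by rewrite ?mulr1 ?mulr0 ?mul0r.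
Qed.

Lemma qform_normalized_laplacian (z : 'rV[R]_#|G|) :
  qform (normalized_laplacian R G) z
  = qform (laplacian R G) (z *m degree_mx_invsqrt R G).
Proof. by rewrite /qform /normalized_laplacian trmx_mul tr_diag_mx !mulmxA. Qed.

Lemma normalized_laplacian_sym :
  (normalized_laplacian R G)^T = normalized_laplacian R G.
Proof.
rewrite /normalized_laplacian !trmx_mul tr_diag_mx mulmxA.
congr (_ *m _ *m _); rewrite /laplacian linearB /= tr_diag_mx; congr (_ - _).
by apply/matrixP => i j; rewrite !mxE adj_sym.
Qed.

(** The energy is nonnegative, so any nonzero test vector will do; the vertex [x] supplies one. *)
Lemma rhoL_ge0 (x : G) : 0 <= rhoL R G.
Proof.
pose z : 'rV[R]_#|G| := delta_mx 0 (enum_rank x).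
have z0 : z != 0.
  by apply/eqP => /rowP/(_ (enum_rank x))/eqP; rewrite !mxE !eqxx oner_eq0.
rewrite -(pmulr_lge0 _ (qform1_gt0 z0)).
apply: le_trans (qform_le_largest_eigenvalue z normalized_laplacian_sym).
by rewrite qform_normalized_laplacian qform_laplacian edge_energy_ge0.
Qed.

(** The substitution [z = D^(1/2) f] turns [rayleigh f] into the Rayleigh quotient of the normalized
    Laplacian at [z]. *)
Lemma rayleigh_le_rhoL (f : {ffun G -> R}) (x0 : G) : rayleigh f <= rhoL R G.
Proof.
rewrite /rayleigh; set d := \sum_x _.
have d_ge0 : 0 <= d by rewrite sumr_ge0 // => x _; rewrite mulr_ge0 ?sqr_ge0.
(* A zero denominator makes the quotient 0 by convention. *)
have [->|d0] := eqVneq d 0; first by rewrite invr0 mulr0 rhoL_ge0.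
rewrite ler_pdivrMr ?lt_def ?d0 //.
pose z : 'rV[R]_#|G| :=
  \row_i (Num.sqrt (deg (enum_val i))%:R * f (enum_val i)).
have := qform_le_largest_eigenvalue z normalized_laplacian_sym.
rewrite -/(rhoL R G) qform_normalized_laplacian qform_laplacian qform1E.
have -> : \sum_i z 0 i ^+ 2 = d.
  rewrite (reindex _ (onW_bij _ (@enum_rank_bij G))); apply: eq_bigr => x _.
  by rewrite mxE enum_rankK exprMn sqr_sqrtr.
congr (_ <= _); congr (_ * _); apply: eq_bigr => x _; apply: eq_bigr => y xy.
(* Undoing the substitution recovers [f] only at vertices of positive degree, which suffices because
   the energy involves only endpoints of edges. *)
have cancel_sqrt a b : adj a b ->
    (z *m degree_mx_invsqrt R G) 0 (enum_rank a) = f a.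
  move=> ab; rewrite mul_mx_diag !mxE enum_rankK mulrAC divff ?mul1r //.
  rewrite sqrtr_eq0 -ltNge ltr0n /deg; apply/card_gt0P; exists b.
  by rewrite inE.
by rewrite !ffunE (cancel_sqrt x y) // (cancel_sqrt y x) // adj_sym.
Qed.

End RayleighQuotient.

(** * Extension by zero to the coalescence *)

Section Extension.
Variables (R : realType) (G1 G2 : sgraph) (u : G1) (v : G2).
Variable f : {ffun G1 -> R}.
Hypothesis fu : f u = 0.

Definition extend0 : {ffun coalescence u v -> R} :=
  [ffun a : coalescence u v => if a is inl x return R then f x else 0].

Lemma edge_energy_extend0 : edge_energy extend0 = edge_energy f.
Proof.
rewrite /edge_energy big_sumType /= [X in _ + X]big1 => [|y _].
  rewrite addr0; congr (_ * _); apply: eq_bigr => x _.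
  (* An edge leaving the copy of [G1] starts at [u], and both its endpoints carry the value 0. *)
  rewrite big_sumType /= [X in _ + X]big1 ?addr0 => [|y /andP[/eqP-> _]].
    by apply: eq_bigr => y _; rewrite !ffunE.
  by rewrite !ffunE fu subr0 expr0n.
apply: big1 => -[x|x] /=; rewrite !ffunE ?subr0 ?expr0n //.
by case/andP=> /eqP-> _; rewrite fu subr0 expr0n.
Qed.

Lemma deg_coalescence (x : G1) :
  x != u -> deg (inl x : coalescence u v) = deg x.
Proof.
move=> xu; rewrite !degE big_sumType /= [X in (_ + X)%N]big_pred0 ?addn0 //.
by move=> y; rewrite (negbTE xu).
Qed.

Lemma rayleigh_extend0 : rayleigh extend0 = rayleigh f.
Proof.
rewrite /rayleigh edge_energy_extend0; congr (_ / _).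
rewrite big_sumType /= [X in _ + X]big1 ?addr0 => [|y _]; last first.
  by rewrite ffunE expr0n mulr0.
apply: eq_bigr => x _; rewrite ffunE.
(* Only [u] can gain neighbours, and there the degree multiplies 0. *)
have [->|xu] := eqVneq x u; first by rewrite fu expr0n !mulr0.
by rewrite deg_coalescence.
Qed.

End Extension.

Theorem theorem4p2 (R : realType) (m n : nat) (G1 G2 : sgraph)
    (orderG1 : #|G1| = m) (orderG2 : #|G2| = n)
    (connG1 : connected_graph G1) (connG2 : connected_graph G2)
    (u : G1) (v : G2) (f1 : {ffun G1 -> R})
    (harm_f1 : harmonic_eigenfunction f1) (f1u : f1 u = 0) :
  rhoL R (coalescence u v) >= rhoL R G1.
Proof.
case: harm_f1 => _ _ <-; rewrite -(rayleigh_extend0 v f1u).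
exact: (@rayleigh_le_rhoL _ (coalescence u v) _ (inl u)).
Qed.
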